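(* Let $\boldsymbol{b}=(b_1,\ldots,b_n)$ with $b_i>0$ for all $i$, and fix $\mu\in[0,\sum_{i=1}^n b_i]$ and $s\in[0,\sum_{i=1}^n b_i]$. For $b>0$ and $t\ge 0$ let $\xi(b,t)=(\exp(bt)-1)/b$. For $t,\lambda\ge 0$ and $i\in\{1,\ldots,n\}$ let $$\tau_i^*(t,\lambda)=\min\left(\max\left(\frac{\xi(b_i,t)-\lambda}{\xi(b_i,t)\,\lambda},\,0\right),\,b_i\right),$$ with the convention that, where the fraction has zero denominator, $\tau_i^*(t,\lambda)=0$ if $t=0$ and $\lambda>0$, and $\tau_i^*(t,\lambda)=b_i$ if $\lambda=0$. Let $$g(t,\lambda;s)=\sum_{i=1}^n\log\left(1+\xi(b_i,t)\,\tau_i^*(t,\lambda)\right)+\lambda\left(\mu-\sum_{i=1}^n\tau_i^*(t,\lambda)\right)-ts .$$ Then $g$ is convex, as a function of the two variables $(t,\lambda)$ with $t,\lambda\ge 0$, and $$\varphi^*_{\boldsymbol{b},\mu}(s)=\min_{t,\lambda\ge 0} g(t,\lambda;s),$$ where $\varphi^*_{\boldsymbol{b},\mu}(s)$ is the worst-case Chernoff--Cramér exponent defined in the context. Moreover, the mapping $t\mapsto\min_{\lambda\ge 0} g(t,\lambda;s)$ is convex, and the mapping $\lambda\mapsto g(t,\lambda;s)$ is convex for each $t\ge 0$.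
   Context: For any scalar $c\ge 0$, $\mathcal{M}_c$ denotes the space of probability distributions with support on $[0,c]$. For a vector $\boldsymbol{b}=(b_1,\ldots,b_n)$ with positive entries and a fixed value $\mu$, let $$\mathcal{M}_{\boldsymbol{b},\mu}=\left\{\boldsymbol{p}=(p_1,\ldots,p_n)\in\prod_{i=1}^n\mathcal{M}_{b_i}:\ \sum_{i=1}^n\mathbb{E}_{X_i\sim p_i}[X_i]\le\mu\right\}.$$ The worst-case Chernoff--Cramér exponent is $$\varphi^*_{\boldsymbol{b},\mu}(s)=\sup_{\boldsymbol{p}\in\mathcal{M}_{\boldsymbol{b},\mu}}\ \inf_{t\ge 0}\left(\sum_{i=1}^n\log\mathbb{E}_{X_i\sim p_i}[\exp(tX_i)]-ts\right).$$ The logarithm is natural.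
   Formalization: The identity is stated with an infimum in the extended reals for all μ, s; that it is a minimum is claimed only if s ≤ μ, or 0 < μ and s < Σb_i. Otherwise it is never attained: φ* = −∞ if μ = 0 < s, and e.g. n = 1, b = s = 1, 0 < μ < 1 gives g > log μ = φ*. *)

(* Defs.v *)
From HB Require Import structures.
From mathcomp Require Import all_boot all_order all_algebra.
From mathcomp Require Import all_classical all_reals all_analysis.

Set Implicit Arguments.
Unset Strict Implicit.
Unset Printing Implicit Defensive.

Import Order.TTheory GRing.Theory Num.Theory.
Import numFieldNormedType.Exports.

Local Open Scope classical_set_scope.
Local Open Scope ring_scope.

Definition distr_on (R : realType) (c : R)
  : set (probability (measurableTypeR R) R) :=
  [set p : probability (measurableTypeR R) R | p `[0, c]%classic = 1%E].

Definition distr_mean_le (R : realType) (n : nat) (b : 'I_n -> R) (mu : R)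
  : set ('I_n -> probability (measurableTypeR R) R) :=
  [set p | (forall i, distr_on (b i) (p i)) /\
           (\sum_(i < n) 'E_(p i)[fun x => x] <= mu%:E)%E].

(* Valued in the extended reals: the value is -oo when mu = 0 < s. *)
Definition chernoff_cramer_exponent (R : realType) (n : nat) (b : 'I_n -> R)
    (mu s : R) : \bar R :=
  ereal_sup [set ereal_inf
      [set (\sum_(i < n) lne 'E_(p i)[fun x => expR (t * x)] - (t * s)%:E)%E
        | t in [set t : R | 0 <= t]]
    | p in distr_mean_le b mu].

Definition xi (R : realType) (b t : R) : R := (expR (b * t) - 1) / b.

(* For b > 0, xi b t = 0 iff t = 0, so the first two branches are exactly the
   pairs at which the fraction has zero denominator. *)
Definition tau_star (R : realType) (b t lam : R) : R :=
  if lam == 0 then b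
  else if t == 0 then 0
  else Num.min (Num.max ((xi b t - lam) / (xi b t * lam)) 0) b.

(* The infimum of dual_g over t, lam >= 0 is not attained when mu < s and
   (mu = 0 or s = \sum_i b i): for mu = 0 < s it is -oo, and for instance for
   n = 1, b = 1, s = 1, 0 < mu < 1 it is ln mu, approached only as t -> +oo.
   It is a minimum in all other cases with 0 <= mu, s <= \sum_i b i. *)
Definition dual_g (R : realType) (n : nat) (b : 'I_n -> R) (mu s t lam : R)
  : R :=
  \sum_(i < n) ln (1 + xi (b i) t * tau_star (b i) t lam)
  + lam * (mu - \sum_(i < n) tau_star (b i) t lam) - t * s.

Definition quadrant (R : realType) : set (R^o * R^o)%type :=
  [set x | 0 <= x.1 /\ 0 <= x.2].
Arguments quadrant : clear implicits.

(* Main.v *)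
(* The function ln(1 + xi(b,t) m) is the log-moment generating function of the
   distribution on {0, b} with mean m. By convexity of exp it dominates that of
   every distribution on [0, b] with mean m, so only the means m_i matter. It is
   convex in t and concave in m, and tau^*_i(t, lam) maximizes it minus lam m over
   [0, b_i]; hence g(t, lam) is the maximum over m of the Lagrangian
     sum_i ln(1 + xi(b_i,t) m_i) + lam (mu - sum_i m_i) - t s,
   which is convex in (t, lam). This gives convexity and weak duality.
   For the reverse inequality, if s <= mu then (0, 0) is optimal with value 0.
   If 0 < mu < s < sum b, then g is Lipschitz and coercive, so it has a minimizer,
   which lies in the interior; there the envelope theorem makes (tau^*, t, lam) a
   saddle point. If mu = 0 < s both sides are -oo, and if mu < s = sum b both
   equal max sum_i ln(m_i / b_i), reached as t -> +oo. *)

From HB Require Import structures.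
Require Import Defs.
From mathcomp Require Import all_boot all_order all_algebra.
From mathcomp Require Import all_classical all_reals all_analysis.
From mathcomp Require Import measurable_realfun ring lra.

Set Implicit Arguments.
Unset Strict Implicit.
Unset Printing Implicit Defensive.

Import Order.TTheory GRing.Theory Num.Theory.
Import numFieldNormedType.Exports.

Local Open Scope classical_set_scope.
Local Open Scope ring_scope.

(** * Chord bounds for the exponential *)

Lemma expR_chord (R : realType) (r x : R) : 0 <= r <= 1 ->
  expR (r * x) <= 1 - r + r * expR x.
Proof.
case/andP=> r0 r1.
have := convex_expR (Itv01 r0 r1) x 0.
by rewrite !convRE/= mulr0 addr0 expR0 mulr1 addrC.
Qed.

Lemma xi0 (R : realType) (b : R) : xi b 0 = 0.
Proof. by rewrite /xi mulr0 expR0 subrr mul0r. Qed.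

Lemma xi_ge0 (R : realType) (b t : R) : 0 < b -> 0 <= t -> 0 <= xi b t.
Proof.
by move=> b0 t0; rewrite divr_ge0 ?(ltW b0)// subr_ge0 -expR0 ler_expR mulr_ge0// ltW.
Qed.

Lemma xi_gt0 (R : realType) (b t : R) : 0 < b -> 0 < t -> 0 < xi b t.
Proof.
by move=> b0 t0; rewrite divr_gt0// subr_gt0 -expR0 ltr_expR mulr_gt0.
Qed.

Lemma xi_chord (R : realType) (b t x : R) : 0 < b -> 0 <= x <= b ->
  expR (t * x) <= 1 + xi b t * x.
Proof.
move=> b0 /andP[x0 xb].
have -> : t * x = x / b * (b * t) by field; rewrite gt_eqF.
have -> : 1 + xi b t * x = 1 - x / b + x / b * expR (b * t).
  by rewrite /xi; field; rewrite gt_eqF.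
by rewrite expR_chord// divr_ge0 ?(ltW b0)//= ler_pdivrMr// mul1r.
Qed.

(** * Means and moment generating functions of laws on a segment *)

Section distributions_on_segments.
Context {R : realType}.
Implicit Types (b m t : R) (p : probability (measurableTypeR R) R).

Let mexp t : measurable_fun [set: measurableTypeR R] (fun x : R => expR (t * x)).
Proof. by apply: measurableT_comp => //; exact: mulrl_measurable. Qed.

(** The law is the image of a Bernoulli law of parameter m/b under true -> b, false -> 0. These laws
    turn the chord bound into an equality. *)
Lemma two_point_distr b m : 0 < b -> 0 <= m <= b ->
  exists p, [/\ distr_on b p, 'E_p[fun x => x]%E = m%:E &
    forall t, 'E_p[fun x => expR (t * x)]%E = (1 + xi b t * m)%:E].
Proof.
move=> b0 /andP[m0 mb].
have q01 : 0 <= m / b <= 1.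
  by rewrite divr_ge0 ?(ltW b0)//= ler_pdivrMr// mul1r.
pose f (c : bool) : measurableTypeR R := if c then b else 0.
have mf : measurable_fun [set: bool] f by [].
pose F : {mfun bool >-> measurableTypeR R} :=
  HB.pack f (isMeasurableFun.Build _ _ _ _ f mf).
pose p : probability (measurableTypeR R) R := distribution (bernoulli_prob (m / b)) F.
exists p; split.
- rewrite /distr_on /= /p /= /distribution /pushforward.
  have -> : F @^-1` `[0, b] = [set: bool].
    by apply/seteqP; split=> // -[] _ /=; rewrite /F/= in_itv/= ?lexx ?(ltW b0).
  exact: probability_setT.
- rewrite unlock integral_distribution//=; last first.
    apply: (@le_integrable _ _ _ _ _ _ _ (cst b%:E)) => //=.
      by move=> [] _ /=; rewrite lee_fin /F/= ?normr0.
    apply/integrableP; split => //; rewrite integral_cst//= probability_setT mule1.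
    exact: ltry.
  rewrite integral_bernoulli_prob//=; last by move=> [] /=; rewrite lee_fin ?(ltW b0).
  by rewrite mule0 adde0 -EFinM divfK// gt_eqF.
- move=> t; rewrite unlock ge0_integral_distribution//=; last first.
    by apply/measurable_EFinP; exact: mexp.
  rewrite integral_bernoulli_prob//=.
  rewrite -!EFinM -EFinD mulr0 expR0 /unstable.onem /xi; congr EFin.
  by rewrite (mulrC t); field; rewrite gt_eqF.
Qed.


(** Integrating [xi_chord] bounds the moment generating function by that of the two-point law with
    the same mean. The lower bound 1 keeps later logarithms in their domain. *)
Lemma distr_on_mgf b p : 0 < b -> distr_on b p -> exists m, [/\ 0 <= m <= b,
  'E_p[fun x => x]%E = m%:E & forall t, 0 <= t ->
  exists e, [/\ 'E_p[fun x => expR (t * x)]%E = e%:E, 1 <= e & e <= 1 + xi b t * m]].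
Proof.
(* Clamping to [0, b] changes nothing p-almost everywhere and makes the bounds on the integrands
   hold at every point. *)
move=> b0 pb; pose c (x : measurableTypeR R) : R := Num.min (Num.max x 0) b.
have mc : measurable_fun setT c.
  by apply: measurable_minr => //; exact: measurable_maxr.
have c0 x : 0 <= c x by rewrite /c le_min le_max lexx orbT ltW.
have cb x : c x <= b by rewrite /c ge_min lexx orbT.
have clampE (f : R -> R) : measurable_fun [set: measurableTypeR R] f ->
    'E_p[f]%E = 'E_p[f \o c]%E.
  move=> mf; rewrite unlock; apply: ae_eq_integral => //.
  - exact/measurable_EFinP.
  - by apply/measurable_EFinP; exact: measurableT_comp.
  exists (~` `[0, b]); split.
  - by apply: measurableC; exact: measurable_itv.
  - rewrite [LHS](_ : _ = p (~` `[0, b]))//.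
    rewrite (@probability_setC _ _ _ p `[0, b]); last exact: measurable_itv.
    by rewrite (pb : p `[0, b]%classic = 1%E) subee.
  - move=> x /= h x0b; apply: h => _; congr (f _)%:E.
    move: x0b; rewrite in_itv/= => /andP[x0 xb].
    by rewrite /c max_l// min_l.
have [m mE] : exists m, 'E_p[c]%E = m%:E.
  have : ('E_p[c] \is a fin_num)%E.
    rewrite ge0_fin_numE ?expectation_ge0//.
    apply: (@le_lt_trans _ _ ('E_p[cst b])%E).
      apply: expectation_le => //; first by move=> x /=; exact: ltW.
      by apply: aeW.
    by rewrite expectation_cst ltry.
  by move/fineK <-; eexists.
exists m; split.
- rewrite -!lee_fin -mE expectation_ge0//=.
  rewrite -(@expectation_cst _ _ _ p b); apply: expectation_le => //.
    by move=> x /=; exact: ltW.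
  by apply: aeW.
- by rewrite clampE// -mE.
- move=> t t0; rewrite clampE//.
  have le1 : (1 <= 'E_p[(fun x => expR (t * x)) \o c])%E.
    rewrite -(@expectation_cst _ _ _ p 1); apply: expectation_le => //=.
    + exact: (measurableT_comp (mexp t) mc).
    + by apply: aeW => x /=; rewrite -expR0 ler_expR mulr_ge0.
  have le2 : ('E_p[(fun x => expR (t * x)) \o c] <= (1 + xi b t * m)%:E)%E.
    have -> : ((1 + xi b t * m)%:E = 'E_p[fun x => (1 + xi b t * c x)%R])%E.
      rewrite unlock.
      under eq_integral do rewrite EFinD EFinM.
      rewrite ge0_integralD//=; last 2 first.
      - by move=> x _; rewrite mule_ge0// lee_fin ?xi_ge0.
      - by apply/measurable_EFinP; apply: measurable_funM.
      rewrite ge0_integralZl//=; last 3 first.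
      - exact/measurable_EFinP.
      - by move=> x _; rewrite lee_fin.
      - by rewrite lee_fin xi_ge0.
      rewrite integral_cst//= probability_setT mule1.
      by move: mE; rewrite unlock => ->; rewrite EFinD EFinM.
    apply: expectation_le => //=.
    + exact: (measurableT_comp (mexp t) mc).
    + by apply: measurable_funD => //; apply: measurable_funM.
    + by move=> x; rewrite addr_ge0// mulr_ge0// xi_ge0.
    + by apply: aeW => x /=; rewrite xi_chord// c0 cb.
  move: le1 le2; case: ('E_p[_])%E => [e| |] //= h1 h2.
  by exists e; split; rewrite -?lee_fin.
Qed.

End distributions_on_segments.

(** * Log-moment generating function of the two-point law *)

Definition lnmgf (R : realType) (b m t : R) : R := ln (1 + xi b t * m).

(** Mean of the two-point law reweighted by e^{t x}, that is, the derivative of [lnmgf b m] at t. *)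
Definition tilted_mean (R : realType) (b m t : R) : R :=
  m * expR (b * t) / (1 + xi b t * m).

Section two_point_log_mgf.
Context {R : realType}.
Implicit Types b m t lam : R.

Lemma mgf_ge1 b m t : 0 < b -> 0 <= m -> 0 <= t -> 1 <= 1 + xi b t * m.
Proof. by move=> b0 m0 t0; rewrite lerDl mulr_ge0// xi_ge0. Qed.

Lemma mgf_gt0 b m t : 0 < b -> 0 <= m -> 0 <= t -> 0 < 1 + xi b t * m.
Proof. by move=> b0 m0 t0; apply: lt_le_trans ltr01 _; exact: mgf_ge1. Qed.

Lemma mgfE b m t : 0 < b -> 1 + xi b t * m = 1 - m / b + m / b * expR (b * t).
Proof. by move=> b0; rewrite /xi; field; rewrite gt_eqF. Qed.

Lemma lnmgf0 b m : lnmgf b m 0 = 0.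
Proof. by rewrite /lnmgf xi0 mul0r addr0 ln1. Qed.

Lemma tilted_mean_itv b m t : 0 < b -> 0 <= m <= b -> 0 <= t ->
  0 <= tilted_mean b m t <= b.
Proof.
move=> b0 /andP[m0 mb] t0; have M0 := mgf_gt0 b0 m0 t0.
rewrite divr_ge0 ?mulr_ge0 ?expR_ge0 ?(ltW M0)//=.
rewrite ler_pdivrMr// mgfE//.
have -> : b * (1 - m / b + m / b * expR (b * t)) = b - m + m * expR (b * t).
  by field; rewrite gt_eqF.
by rewrite lerDr subr_ge0.
Qed.

(* The ratio of the two moment generating functions is 1 - r + r e^x with
   x = b(t' - t) and b r the tilted mean at t, to which [expR_chord] applies. *)
Lemma lnmgf_tangent b m t t' : 0 < b -> 0 <= m <= b -> 0 <= t -> 0 <= t' ->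
  lnmgf b m t + (t' - t) * tilted_mean b m t <= lnmgf b m t'.
Proof.
move=> b0 m_itv t0 t'0; have /andP[m0 mb] := m_itv.
have /andP[r0 r1] := tilted_mean_itv b0 m_itv t0.
have M0 := mgf_gt0 b0 m0 t0; have M'0 := mgf_gt0 b0 m0 t'0.
rewrite /lnmgf -ler_expR expRD !lnK ?posrE//.
set r := tilted_mean b m t in r0 r1 *.
have -> : (t' - t) * r = r / b * (b * t' - b * t) by field; rewrite gt_eqF.
have r01 : 0 <= r / b <= 1.
  by rewrite divr_ge0 ?(ltW b0)//= ler_pdivrMr// mul1r.
apply: le_trans (ler_wpM2l (ltW M0) (expR_chord _ r01)) _.
rewrite expRD expRN /r /tilted_mean (mgfE m t' b0) [leLHS](_ : _ =
  (1 + xi b t * m) - m / b * expR (b * t) + m / b * expR (b * t')); last first.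
  by field; rewrite !gt_eqF// expR_gt0.
by rewrite mgfE// addrK.
Qed.

(** Average the tangent inequalities at the mixed point: the slope terms cancel. *)
Lemma lnmgf_convex b m t1 t2 p : 0 < b -> 0 <= m <= b -> 0 <= t1 -> 0 <= t2 ->
  0 <= p <= 1 -> lnmgf b m (p * t1 + (1 - p) * t2) <=
  p * lnmgf b m t1 + (1 - p) * lnmgf b m t2.
Proof.
move=> b0 mb t10 t20 /andP[p0 p1].
have t0 : 0 <= p * t1 + (1 - p) * t2 by rewrite addr_ge0// mulr_ge0// subr_ge0.
have h1 := ler_wpM2l p0 (lnmgf_tangent b0 mb t0 t10).
have := ler_wpM2l (_ : 0 <= 1 - p) (lnmgf_tangent b0 mb t0 t20).
rewrite subr_ge0 => /(_ p1) h2.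
apply: le_trans (lerD h1 h2); rewrite le_eqVlt; apply/orP; left; apply/eqP.
move: (lnmgf b m (_ + _)) (tilted_mean _ _ _) => y d; ring.
Qed.

(** The tangent slope is a tilted mean, hence lies in [0, b]. *)
Lemma lnmgf_lipschitz b m t t' : 0 < b -> 0 <= m <= b -> 0 <= t -> 0 <= t' ->
  lnmgf b m t <= lnmgf b m t' + b * `|t - t'|.
Proof.
move=> b0 mb t0 t'0; have tan := lnmgf_tangent b0 mb t0 t'0.
have /andP[d0 db] := tilted_mean_itv b0 mb t0.
have h1 : (t - t') * tilted_mean b m t <= `|t - t'| * tilted_mean b m t.
  by rewrite ler_wpM2r// ler_norm.
have h2 : `|t - t'| * tilted_mean b m t <= `|t - t'| * b by rewrite ler_wpM2l.
lra.
Qed.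

Lemma lnmgf_ge_mean b m t : 0 < b -> 0 <= m <= b -> 0 <= t -> t * m <= lnmgf b m t.
Proof.
move=> b0 mb t0; have := lnmgf_tangent b0 mb (lexx 0) t0.
by rewrite lnmgf0 add0r subr0 /tilted_mean xi0 mul0r addr0 mulr0 expR0 mulr1 divr1.
Qed.

(** Discard the atom at 0 and keep the mass m/b at b. *)
Lemma lnmgf_ge_top b m t : 0 < b -> 0 < m <= b ->
  ln (m / b) + b * t <= lnmgf b m t.
Proof.
move=> b0 /andP[m0 mb]; have e0 := expR_gt0 (b * t).
have q0 : 0 < m / b by rewrite divr_gt0.
have q1 : m / b <= 1 by rewrite ler_pdivrMr// mul1r.
rewrite -[b * t]expRK -lnM ?posrE// /lnmgf ler_ln ?posrE ?mulr_gt0// ?invr_gt0//.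
  by rewrite mgfE// lerDr subr_ge0.
by rewrite mgfE// ltr_wpDl ?subr_ge0// mulr_gt0.
Qed.

(* Concavity of ln at the point (m / b) e^{b t}, with m = min(u, b): there
   the slope 1/m is u^-1, or at least u^-1 when the constraint tau <= b binds. *)
Lemma lnmgf_le_top c u tau t : 0 < c -> 0 < u -> 0 <= tau <= c -> 0 <= t ->
  lnmgf c tau t - c * t <= ln (Num.min u c / c) +
    u^-1 * (tau - Num.min u c) + expR (- (c * t)) * c / Num.min u c.
Proof.
move=> c0 u0 /andP[tau0 taub] t0; set m := Num.min u c.
have m0 : 0 < m by rewrite lt_min u0.
have E0 := expR_gt0 (c * t); have M0 := mgf_gt0 c0 tau0 t0.
have slope : (tau - m) / m <= u^-1 * (tau - m).
  rewrite mulrC /m; have [cu|uc] := leP c u; last by [].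
  by apply: ler_wnM2r; rewrite ?subr_le0// lef_pV2.
have den0 : 0 < m / c * expR (c * t) by rewrite mulr_gt0// divr_gt0.
have : ln ((1 + xi c t * tau) / (m / c * expR (c * t))) <=
    (1 + xi c t * tau) / (m / c * expR (c * t)) - 1.
  have := @le_ln1Dx _ ((1 + xi c t * tau) / (m / c * expR (c * t)) - 1).
  by rewrite addrCA subrr addr0; apply; rewrite ltrBrDl subrr divr_gt0.
rewrite ln_div ?posrE// lnM ?posrE ?divr_gt0// expRK -/(lnmgf c tau t).
have -> : (1 + xi c t * tau) / (m / c * expR (c * t)) - 1 =
    expR (- (c * t)) * (c - tau) / m + (tau - m) / m.
  by rewrite mgfE// expRN; field; rewrite !gt_eqF.
have : expR (- (c * t)) * (c - tau) / m <= expR (- (c * t)) * c / m.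
  by rewrite ler_wpM2r ?invr_ge0 ?(ltW m0)// ler_wpM2l ?expR_ge0// gerBl.
lra.
Qed.

Lemma tau_star_itv b t lam : 0 < b -> 0 <= tau_star b t lam <= b.
Proof.
move=> b0; rewrite /tau_star; case: ifP => _; first by rewrite (ltW b0) lexx.
case: ifP => _; first by rewrite lexx ltW.
by rewrite le_min le_max lexx orbT (ltW b0) ge_min lexx orbT.
Qed.

Lemma tau_star_max b t lam m : 0 < b -> 0 <= t -> 0 <= lam -> 0 <= m <= b ->
  lnmgf b m t - lam * m <=
  lnmgf b (tau_star b t lam) t - lam * tau_star b t lam.
Proof.
move=> b0 t0 lam0 /andP[m0 mb]; have M0 := mgf_gt0 b0 m0 t0.
have /andP[v0 vb] := tau_star_itv t lam b0.
have V0 := mgf_gt0 b0 v0 t0; have xi_ge := xi_ge0 b0 t0.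
(* [H] is the first-order optimality condition at [tau_star] with denominators cleared; concavity of
   ln, as ln z <= z - 1, makes it sufficient. *)
suff H : xi b t * (m - tau_star b t lam) <=
    lam * (m - tau_star b t lam) * (1 + xi b t * tau_star b t lam).
  have : lnmgf b m t - lnmgf b (tau_star b t lam) t <= lam * (m - tau_star b t lam).
    rewrite /lnmgf -ln_div ?posrE//.
    apply: le_trans (_ : (1 + xi b t * m) / (1 + xi b t * tau_star b t lam) - 1 <= _).
      have := @le_ln1Dx _ ((1 + xi b t * m) / (1 + xi b t * tau_star b t lam) - 1).
      by rewrite addrCA subrr addr0; apply; rewrite ltrBrDl subrr divr_gt0.
    rewrite lerBlDr ler_pdivrMr// mulrDl mul1r; nra.
  lra.
rewrite /tau_star; case: eqVneq => [->|l0].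
  by rewrite !mul0r mulr_ge0_le0// subr_le0.
case: eqVneq => [->|t_neq0]; first by rewrite xi0 !mul0r addr0 mulr1 subr0 mulr_ge0.
have {}lam0 : 0 < lam by rewrite lt_neqAle eq_sym l0.
have {}t0 : 0 < t by rewrite lt_neqAle eq_sym t_neq0.
have x0 := xi_gt0 b0 t0; move: (xi b t) x0 => x x0.
set w := (x - lam) / _.
have wx : w * (x * lam) = x - lam by rewrite /w divfK// mulf_neq0 ?gt_eqF.
have wE : 1 + x * w = x / lam by rewrite /w; field; rewrite !gt_eqF.
(* Here w is the stationary point. The slope in m at the clipped point is nonpositive if w < 0
   (clipped to 0), nonnegative if w > b (clipped to b), and zero otherwise. *)
have [w_lt0|w_ge0] := ltP w 0.
  have xl : x <= lam by rewrite -subr_le0 -wx nmulr_rle0 ?ltW// mulr_gt0.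
  by rewrite min_l ?(ltW b0)// mulr0 addr0 mulr1 subr0; apply: ler_wpM2r.
have [bw|wb] := ltP b w.
  have h : lam * (1 + x * b) <= x.
    have : b * (x * lam) <= w * (x * lam) by rewrite ler_wpM2r ?mulr_ge0// ltW.
    rewrite wx; lra.
  rewrite mulrAC; apply: ler_wnM2r; first by rewrite subr_le0.
  by [].
rewrite wE; have -> : lam * (m - w) * (x / lam) = x * (m - w) by field; rewrite gt_eqF.
by [].
Qed.

End two_point_log_mgf.

(** * Continuity of the optimal and tilted means *)

Section continuity.
Context {R : realType}.
Implicit Types b t lam : R.

Lemma continuous_xi b : continuous (xi b).
Proof.
move=> t; apply: (@cvgMl _ _ _ _ (fun t => expR (b * t) - 1)).
apply: cvgB; last exact: cvg_cst.
apply: (@continuous_comp _ _ _ (fun t => b * t) expR); last exact: continuous_expR.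
by apply: cvgMr; exact: cvg_id.
Qed.

(* [tau_star] without its branches at zero, hence continuous for t, lam > 0. *)
Definition clipped_mean b t lam : R :=
  Num.min (Num.max ((xi b t - lam) / (xi b t * lam)) 0) b.

Lemma tau_star_clipped b t lam : 0 < t -> 0 < lam ->
  tau_star b t lam = clipped_mean b t lam.
Proof. by move=> t0 lam0; rewrite /tau_star !gt_eqF. Qed.

Lemma clipped_mean_itv b t lam : 0 < b -> 0 <= clipped_mean b t lam <= b.
Proof.
by move=> b0; rewrite le_min le_max lexx orbT (ltW b0) ge_min lexx orbT.
Qed.

Lemma clipped_mean_continuous b (u v : R -> R) x : 0 < b ->
  {for x, continuous u} -> {for x, continuous v} -> 0 < u x -> 0 < v x ->
  {for x, continuous (fun y => clipped_mean b (u y) (v y))}.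
Proof.
move=> b0 uc vc u0 v0.
have xc : {for x, continuous (fun y => xi b (u y))}.
  by apply: continuous_comp => //; exact: continuous_xi.
apply: (@continuous_min _ _ (fun y => Num.max _ 0) (cst b)); last exact: cvg_cst.
apply: (@continuous_max _ _ _ (cst 0)); last exact: cvg_cst.
apply: cvgM; first exact: cvgB.
apply: cvgV; last exact: cvgM.
by rewrite mulf_neq0 ?gt_eqF// xi_gt0.
Qed.

Lemma tilted_mean_continuous b (u : R -> R) t : 0 < b -> 0 <= t ->
  0 <= u t -> {for t, continuous u} ->
  {for t, continuous (fun t => tilted_mean b (u t) t)}.
Proof.
move=> b0 t0 u0 uc; apply: cvgM.
  apply: cvgM => //.
  apply: (@continuous_comp _ _ _ (fun t => b * t) expR); last exact: continuous_expR.
  by apply: cvgMr; exact: cvg_id.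
apply: cvgV; first by rewrite gt_eqF// mgf_gt0.
apply: cvgD; first exact: cvg_cst.
by apply: cvgM => //; exact: continuous_xi.
Qed.

Lemma continuous_sum n (F : 'I_n -> R -> R) x :
  (forall i, {for x, continuous (F i)}) ->
  {for x, continuous (fun y => \sum_(i < n) F i y)}.
Proof. by move=> Fc; apply: cvg_big => [|i _]; [exact: add_continuous|exact: Fc]. Qed.

End continuity.

(** * Attained minima and zeros of real functions *)

Section real_functions.
Context {R : realType}.
Implicit Types (f : R -> R) (x y C T : R).

(** The even extension of f is continuous on the whole line, so it has a minimum on [0, T]; beyond
    T, f is at least f x0. *)
Lemma lipschitz_ge0_attains_min f C x0 T : 0 <= C -> 0 <= x0 <= T ->
  (forall x y, 0 <= x -> 0 <= y -> f x <= f y + C * `|x - y|) ->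
  (forall x, T <= x -> f x0 <= f x) ->
  exists2 x, 0 <= x & forall y, 0 <= y -> f x <= f y.
Proof.
move=> C0 /andP[x00 x0T] f_lip f_ge; have T0 := le_trans x00 x0T.
pose h x := f `|x|.
have h_lip x y : h x <= h y + C * `|x - y|.
  apply: le_trans (f_lip _ _ (normr_ge0 x) (normr_ge0 y)) _.
  by rewrite lerD2l ler_wpM2l// ler_dist_dist.
have h_cont : continuous h.
  move=> x; apply/cvgrPdist_lt => e e0; near=> y.
  (* C may vanish, hence the denominator C + 1. *)
  have xy : `|x - y| < e / (C + 1).
    by near: y; exists (e / (C + 1)) => //=; rewrite divr_gt0// ltr_wpDl.
  apply: le_lt_trans (_ : C * `|x - y| < e); last first.
    move: xy; rewrite ltr_pdivlMr ?ltr_wpDl//; have := normr_ge0 (x - y); nra.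
  rewrite ler_norml; have := h_lip x y; have := h_lip y x.
  rewrite (distrC y); lra.
have [x] := EVT_min T0 (continuous_subspaceT h_cont).
rewrite in_itv/= => /andP[x_ge0 xT] hx; exists x => // y y0.
have hxE z : 0 <= z <= T -> f x <= f z.
  move=> /andP[z0 zT]; have := hx z; rewrite in_itv/= z0 zT => /(_ isT).
  by rewrite /h !ger0_norm.
have [yT|/ltW Ty] := leP y T; first by rewrite hxE// y0.
by apply: le_trans (f_ge _ Ty); rewrite hxE// x00.
Unshelve. all: by end_near. Qed.

(** A nonzero f x would keep its sign near x, while y - x takes both signs. This extracts
    stationarity from a minimum without differentiating the dual. *)
Lemma sign_change_eq0 f x : 0 < x -> {for x, continuous f} ->
  (forall y, 0 < y -> 0 <= (y - x) * f y) -> f x = 0.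
Proof.
move=> x0 f_cont f_sign; apply/eqP; apply: contraT; rewrite neq_lt => /orP[fx|fx].
- have : \forall y \near x, f y < 0 by exact: cvgr_lt (f_cont) _ fx.
  case=> e /= e0 he; have : f (x + e / 2) < 0.
    apply: he; rewrite /= opprD addrA subrr add0r normrN gtr0_norm ?divr_gt0//.
    by rewrite ltr_pdivrMr// ltr_pMr// ltr1n.
  have := f_sign (x + e / 2); rewrite addr_gt0 ?divr_gt0// => /(_ isT).
  have : 0 < e / 2 by rewrite divr_gt0.
  nra.
- have : \forall y \near x, 0 < f y by exact: cvgr_gt (f_cont) _ fx.
  (* The minimum with x keeps x - d positive, where the sign hypothesis applies. *)
  case=> e /= e0 he; pose d := Num.min e x / 2.
  have d0 : 0 < d by rewrite divr_gt0// lt_min e0 x0.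
  have dle (z : R) : Num.min e x <= z -> 0 < z -> d < z.
    by move=> ez z0; apply: le_lt_trans (_ : z / 2 < z); rewrite /d; lra.
  have : 0 < f (x - d).
    apply: he; rewrite /= opprB addrCA subrr addr0 gtr0_norm//.
    by rewrite dle// ge_min lexx.
  have dx : d < x by rewrite dle// ge_min lexx orbT.
  have := f_sign (x - d); rewrite subr_gt0 => /(_ dx).
  nra.
Qed.

End real_functions.

(** * The Lagrangian and the dual function: convexity and Lipschitz bounds *)

Section dual_function.
Context {R : realType} {n : nat} (b : 'I_n -> R) (mu s : R).
Context (b_gt0 : forall i, 0 < b i).
Context (mu_itv : 0 <= mu <= \sum_(i < n) b i).
Context (s_itv : 0 <= s <= \sum_(i < n) b i).
Implicit Types (m : 'I_n -> R) (t lam : R).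

Local Notation B := (\sum_(i < n) b i).
Local Notation g := (dual_g b mu s).
Local Notation box m := (forall i, 0 <= m i <= b i).

Lemma sum_widths_ge0 : 0 <= B.
Proof. by apply: sumr_ge0 => i _; exact: ltW. Qed.

Lemma box_sum_itv m : box m -> 0 <= \sum_(i < n) m i <= B.
Proof.
move=> mb; apply/andP; split.
  by apply: sumr_ge0 => i _; case/andP: (mb i).
by apply: ler_sum => i _; case/andP: (mb i).
Qed.

Definition lagrangian m t lam :=
  \sum_(i < n) lnmgf (b i) (m i) t + lam * (mu - \sum_(i < n) m i) - t * s.

Definition opt_means t lam i := tau_star (b i) t lam.

Lemma dual_g_lagrangian t lam : g t lam = lagrangian (opt_means t lam) t lam.
Proof. by []. Qed.

Lemma opt_means_box t lam : box (opt_means t lam).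
Proof. by move=> i; exact: tau_star_itv. Qed.

Lemma lagrangian_le m t lam : 0 <= t -> 0 <= lam -> box m ->
  lagrangian m t lam <= g t lam.
Proof.
move=> t0 lam0 mb; rewrite dual_g_lagrangian /lagrangian !mulrBr !mulr_sumr lerD2r.
rewrite addrCA [leRHS]addrCA lerD2l -!sumrB; apply: ler_sum => i _.
exact: tau_star_max.
Qed.

(** For fixed m the variables separate: convex in t plus affine in lam, which yields joint
    convexity. *)
Lemma lagrangian_convex m t1 t2 lam1 lam2 p : box m -> 0 <= t1 -> 0 <= t2 ->
  0 <= p <= 1 -> lagrangian m (p * t1 + (1 - p) * t2) (p * lam1 + (1 - p) * lam2)
  <= p * lagrangian m t1 lam1 + (1 - p) * lagrangian m t2 lam2.
Proof.
move=> mb t10 t20 p01; rewrite /lagrangian.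
set S := \sum_(i < n) m i.
have : \sum_(i < n) lnmgf (b i) (m i) (p * t1 + (1 - p) * t2) <=
    p * (\sum_(i < n) lnmgf (b i) (m i) t1) +
    (1 - p) * (\sum_(i < n) lnmgf (b i) (m i) t2).
  by rewrite !mulr_sumr -big_split/=; apply: ler_sum => i _; exact: lnmgf_convex.
lra.
Qed.

(** In t, the log-moment generating functions and the term t s contribute B each; in lam, the slope
    is a difference of two numbers in [0, B]. The constants do not depend on m. *)
Lemma lagrangian_lipschitz m t t' lam lam' : box m -> 0 <= t -> 0 <= t' ->
  lagrangian m t lam <= lagrangian m t' lam' + 2 * B * `|t - t'| + B * `|lam - lam'|.
Proof.
move=> mb t0 t'0; rewrite /lagrangian.
have h1 : \sum_(i < n) lnmgf (b i) (m i) t <=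
    \sum_(i < n) lnmgf (b i) (m i) t' + B * `|t - t'|.
  by rewrite mulr_suml -big_split/=; apply: ler_sum => i _; exact: lnmgf_lipschitz.
have h2 : (lam - lam') * (mu - \sum_(i < n) m i) <= B * `|lam - lam'|.
  rewrite mulrC; apply: le_trans (ler_norm _) _; rewrite normrM ler_wpM2r//.
  by rewrite ler_norml; move: (box_sum_itv mb) mu_itv; lra.
have h3 : (t' - t) * s <= B * `|t - t'|.
  rewrite mulrC; apply: le_trans (ler_norm _) _; rewrite normrM (distrC t').
  by rewrite ler_wpM2r// ger0_norm; case/andP: s_itv.
lra.
Qed.

(** The maximizer at (t, lam) is a competitor at (t', lam'), so a bound uniform in m passes to the
    maximum. *)
Lemma dual_g_lipschitz t t' lam lam' :
  0 <= t -> 0 <= t' -> 0 <= lam -> 0 <= lam' ->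
  g t lam <= g t' lam' + 2 * B * `|t - t'| + B * `|lam - lam'|.
Proof.
move=> t0 t'0 lam0 lam'0; rewrite dual_g_lagrangian.
apply: le_trans (lagrangian_lipschitz _ lam' (opt_means_box t lam) t0 t'0) _.
do 2 apply: lerD => //; apply: lagrangian_le => //; exact: opt_means_box.
Qed.

(** A maximum of convex functions is convex: the maximizer at the mixed point competes at both
    endpoints. *)
Lemma dual_g_convex t1 t2 lam1 lam2 p :
  0 <= t1 -> 0 <= t2 -> 0 <= lam1 -> 0 <= lam2 -> 0 <= p <= 1 ->
  g (p * t1 + (1 - p) * t2) (p * lam1 + (1 - p) * lam2)
  <= p * g t1 lam1 + (1 - p) * g t2 lam2.
Proof.
move=> t10 t20 lam10 lam20 p01; rewrite dual_g_lagrangian.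
apply: le_trans (lagrangian_convex _ _ (opt_means_box _ _) t10 t20 p01) _.
case/andP: p01 => p0 p1; apply: lerD; apply: ler_wpM2l; rewrite ?subr_ge0//.
  by apply: lagrangian_le => //; exact: opt_means_box.
by apply: lagrangian_le => //; exact: opt_means_box.
Qed.

Lemma dual_g_ge t lam : 0 <= t -> 0 <= lam -> lam * mu - t * s <= g t lam.
Proof.
move=> t0 lam0; apply: le_trans (lagrangian_le (m := fun=> 0) t0 lam0 _).
  rewrite /lagrangian big1 ?add0r; first by rewrite big1 ?subr0.
  by move=> i _; rewrite /lnmgf mulr0 addr0 ln1.
by move=> i; rewrite lexx ltW.
Qed.

(** Each summand satisfies ln(1 + xi m) - lam m <= (xi - lam) m <= 0. With [dual_g_ge], the dual is
    affine in this region. *)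
Lemma dual_g_le t lam : 0 <= t -> (forall i, xi (b i) t <= lam) ->
  g t lam <= lam * mu - t * s.
Proof.
move=> t0 xi_le; rewrite dual_g_lagrangian /lagrangian lerD2r.
rewrite mulrBr addrCA gerDl mulr_sumr -sumrB; apply: sumr_le0 => i _.
have /andP[m0 _] := opt_means_box t lam i; have x0 := xi_ge0 (b_gt0 i) t0.
rewrite subr_le0; apply: le_trans (_ : xi (b i) t * opt_means t lam i <= _).
  by apply: le_ln1Dx; apply: lt_le_trans (_ : 0 <= _); rewrite ?ltrN10// mulr_ge0.
by rewrite ler_wpM2r.
Qed.

Lemma dual_g00 : g 0 0 <= 0.
Proof.
apply: le_trans (dual_g_le (lexx 0) _) _; last by rewrite !mul0r subr0.
by move=> i; rewrite xi0.
Qed.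

(** * Minimization of the dual, first over lam and then over t *)

Lemma dual_g_lam_min t : 0 <= t ->
  exists2 lam, 0 <= lam & forall lam', 0 <= lam' -> g t lam <= g t lam'.
Proof.
move=> t0; have [mu0 _] := andP mu_itv.
(* T dominates every xi(b_i, t), so for lam >= T the dual is lam mu - t s, nondecreasing in lam. *)
pose T := \sum_(i < n) xi (b i) t.
have T0 : 0 <= T by apply: sumr_ge0 => i _; rewrite xi_ge0.
apply: (@lipschitz_ge0_attains_min _ (g t) B T T) => //.
- exact: sum_widths_ge0.
- by rewrite T0 lexx.
- by move=> x y x0 y0; have := dual_g_lipschitz t0 t0 x0 y0; rewrite subrr normr0; lra.
- move=> x Tx; apply: le_trans (dual_g_ge t0 (le_trans T0 Tx)).
  apply: le_trans (dual_g_le t0 _) _; last by rewrite lerD2r ler_wpM2r.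
  by move=> i; rewrite /T (bigD1 i)//= lerDl sumr_ge0// => j _; rewrite xi_ge0.
Qed.

(** A real infimum is informative only for sets bounded below; for t >= 0 this holds because the
    minimum is attained. *)
Definition dual_value t := inf [set g t lam | lam in [set l : R | 0 <= l]].

Lemma dual_valueP t : 0 <= t -> exists lam,
  [/\ 0 <= lam, dual_value t = g t lam &
      forall lam', 0 <= lam' -> dual_value t <= g t lam'].
Proof.
move=> t0; have [lam lam0 lam_min] := dual_g_lam_min t0.
have E : dual_value t = g t lam.
  apply/eqP; rewrite eq_le; apply/andP; split.
    apply: ge_inf; last by exists lam.
    by exists (g t lam) => _ [l l0 <-]; exact: lam_min.
  by apply: lb_le_inf; [exists (g t lam), lam|move=> _ [l l0 <-]; exact: lam_min].
by exists lam; split => // l l0; rewrite E lam_min.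
Qed.

(** Partial minimization preserves joint convexity: mix the minimizers at the two endpoints. *)
Lemma dual_value_convex t1 t2 p : 0 <= t1 -> 0 <= t2 -> 0 <= p <= 1 ->
  dual_value (p * t1 + (1 - p) * t2) <= p * dual_value t1 + (1 - p) * dual_value t2.
Proof.
move=> t10 t20 p01; have [p0 p1] := andP p01; have q0 : 0 <= 1 - p by rewrite subr_ge0.
have [l1 [l10 -> _]] := dual_valueP t10; have [l2 [l20 -> _]] := dual_valueP t20.
apply: le_trans (dual_g_convex t10 t20 l10 l20 p01).
have [|_ [_ _ ->//]] := @dual_valueP (p * t1 + (1 - p) * t2).
  by rewrite addr_ge0// mulr_ge0.
by rewrite addr_ge0// mulr_ge0.
Qed.

Lemma feasible_means : exists m,
  [/\ box m, \sum_(i < n) m i = mu & 0 < mu -> forall i, 0 < m i].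
Proof.
have [mu0 muB] := andP mu_itv.
exists (fun i => b i * (mu / B)).
(* As the widths are positive, B = 0 means n = 0. *)
have [B0|B_neq0] := eqVneq B 0.
  have mu_eq0 : mu = 0 by apply/le_anti; rewrite mu0 -[leRHS]B0 muB.
  split; last by rewrite mu_eq0 ltxx.
    by move=> i; rewrite mu_eq0 mul0r mulr0 lexx ltW.
  by rewrite mu_eq0 mul0r big1// => i; rewrite mulr0.
have B_gt0 : 0 < B by rewrite lt_neqAle eq_sym B_neq0 sum_widths_ge0.
split.
- move=> i; rewrite mulr_ge0 ?divr_ge0 ?sum_widths_ge0 ?(ltW (b_gt0 i))//=.
  by rewrite ler_piMr ?(ltW (b_gt0 i))// ler_pdivrMr// mul1r.
- by rewrite -mulr_suml mulrC divfK.
- by move=> mu_gt0 i; rewrite mulr_gt0// divr_gt0.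
Qed.

Lemma dual_g_min : 0 < mu -> s < B -> exists t lam, [/\ 0 <= t, 0 <= lam &
  forall t' lam', 0 <= t' -> 0 <= lam' -> g t lam <= g t' lam'].
Proof.
move=> mu_gt0 sB; have [m [mb mmu /(_ mu_gt0) m_gt0]] := feasible_means.
pose c := \sum_(i < n) ln (m i / b i).
have Bs : 0 < B - s by rewrite subr_gt0.
(* Means with sum exactly mu cancel the multiplier term, so the growth in t is uniform in lam. *)
have growth t lam : 0 <= t -> 0 <= lam -> c + t * (B - s) <= g t lam.
  move=> t0 lam0; apply: le_trans (lagrangian_le t0 lam0 mb).
  rewrite /lagrangian mmu subrr mulr0 addr0 mulrBr addrA lerD2r.
  rewrite mulr_sumr -big_split/=; apply: ler_sum => i _.
  have [m0 mbi] := andP (mb i).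
  by rewrite (mulrC t) lnmgf_ge_top ?m_gt0.
(* Beyond this threshold [growth] gives values at least 0, whereas the value at t = 0 is at most
   g(0, 0) <= 0. *)
have T0 : 0 <= `|c| / (B - s) by rewrite divr_ge0// ltW.
have [||||t t0 t_min] :=
  @lipschitz_ge0_attains_min _ dual_value (2 * B) 0 (`|c| / (B - s)).
- by rewrite mulr_ge0// sum_widths_ge0.
- by rewrite lexx.
- move=> x y x0 y0; have [ly [ly0 -> _]] := dual_valueP y0.
  have [_ [_ _ /(_ _ ly0) h]] := dual_valueP x0; apply: le_trans h _.
  have := dual_g_lipschitz x0 y0 ly0 ly0; rewrite subrr normr0; lra.
- move=> x Tx; have x0 := le_trans T0 Tx.
  have [_ [_ _ /(_ 0 (lexx 0)) h]] := dual_valueP (lexx 0); apply: le_trans h _.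
  apply: le_trans dual_g00 _; have [l [l0 -> _]] := dual_valueP x0.
  apply: le_trans (growth _ _ x0 l0); move: Tx; rewrite ler_pdivrMr//.
  have := ler_norm (- c); rewrite normrN; lra.
have [lam [lam0 E _]] := dual_valueP t0.
exists t, lam; split => // t' lam' t'0 lam'0; rewrite -E.
by apply: le_trans (t_min _ t'0) _; have [_ [_ _ ->]] := dual_valueP t'0.
Qed.

(** * Weak duality and lower bounds from two-point laws *)

Lemma exponent_le t lam : 0 <= t -> 0 <= lam ->
  (chernoff_cramer_exponent b mu s <= (g t lam)%:E)%E.
Proof.
move=> t0 lam0; apply: ge_ereal_sup => _ [p [p_supp p_mean] <-].
have /choice[m mP] : forall i, exists m : R, [/\ 0 <= m <= b i,
    'E_(p i)[fun x => x]%E = m%:E & forall t, 0 <= t ->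
    exists e, [/\ 'E_(p i)[fun x => expR (t * x)]%E = e%:E, 1 <= e &
                  e <= 1 + xi (b i) t * m]].
  by move=> i; exact: distr_on_mgf.
have /choice[e eP] : forall i, exists e : R,
    [/\ 'E_(p i)[fun x => expR (t * x)]%E = e%:E, 1 <= e &
        e <= 1 + xi (b i) t * m i].
  by move=> i; have [_ _] := mP i; exact.
have mb : box m by move=> i; case: (mP i).
have m_mu : \sum_(i < n) m i <= mu.
  rewrite -lee_fin -sumEFin; apply: le_trans p_mean; rewrite le_eqVlt.
  by apply/orP; left; apply/eqP; apply: eq_bigr => i _; case: (mP i).
apply: le_trans (_ : (\sum_(i < n) ln (e i) - t * s)%:E <= _)%E.
  apply: ereal_inf_lbound; exists t => //; rewrite EFinB -sumEFin.
  congr (_ - _)%E; apply: eq_bigr => i _; have [-> e1 _] := eP i.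
  by rewrite lne_EFin// (lt_le_trans ltr01).
rewrite lee_fin; apply: le_trans (lagrangian_le t0 lam0 mb).
(* The multiplier term is nonnegative because the means sum to at most mu. *)
rewrite /lagrangian lerD2r -[leLHS]addr0 lerD ?mulr_ge0 ?subr_ge0//.
apply: ler_sum => i _; have [_ e1 ei] := eP i.
by rewrite /lnmgf ler_ln ?posrE ?(lt_le_trans ltr01)// (le_trans e1).
Qed.

Lemma exponent_ge m y : box m -> \sum_(i < n) m i <= mu ->
  (forall t, 0 <= t -> y <= \sum_(i < n) lnmgf (b i) (m i) t - t * s) ->
  (y%:E <= chernoff_cramer_exponent b mu s)%E.
Proof.
move=> mb m_mu y_le.
have /choice[p pP] := fun i => two_point_distr (b_gt0 i) (mb i).
apply: le_trans; last first.
  apply: ereal_sup_ubound; exists p => //; split; first by move=> i; case: (pP i).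
  rewrite (eq_bigr (fun i => (m i)%:E)); first by rewrite sumEFin lee_fin.
  by move=> i _; case: (pP i).
apply: le_ereal_inf_tmp => _ [t /= t0 <-].
rewrite (eq_bigr (fun i => (lnmgf (b i) (m i) t)%:E)).
  by rewrite sumEFin -EFinB lee_fin y_le.
move=> i _; have [_ _ ->] := pP i.
by rewrite lne_EFin// mgf_gt0//; case/andP: (mb i).
Qed.

Lemma exponent_le_dual : (chernoff_cramer_exponent b mu s <=
  ereal_inf [set (g x.1 x.2)%:E | x in quadrant R])%E.
Proof. by apply: le_ereal_inf_tmp => _ [x [x1 x2] <-]; exact: exponent_le. Qed.

Lemma exponent_attained t lam : 0 <= t -> 0 <= lam ->
  ((g t lam)%:E <= chernoff_cramer_exponent b mu s)%E ->
  chernoff_cramer_exponent b mu s = (g t lam)%:E /\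
  chernoff_cramer_exponent b mu s =
    ereal_inf [set (g x.1 x.2)%:E | x in quadrant R].
Proof.
move=> t0 lam0 gE; split; first by apply/le_anti; rewrite exponent_le.
apply/le_anti; rewrite exponent_le_dual/=; apply: le_trans gE.
by apply: ereal_inf_lbound; exists (t, lam).
Qed.

(** With means summing to mu, Jensen's bound gives a log-moment generating function of at least t mu
    >= t s. *)
Lemma exponent_ge0 : s <= mu -> (0 <= chernoff_cramer_exponent b mu s)%E.
Proof.
move=> s_mu; have [m [mb m_mu _]] := feasible_means.
apply: (exponent_ge mb); first by rewrite m_mu.
move=> t t0; rewrite subr_ge0; apply: le_trans (_ : t * mu <= _).
  by rewrite ler_wpM2l.
by rewrite -m_mu mulr_sumr; apply: ler_sum => i _; exact: lnmgf_ge_mean.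
Qed.

(** * Interior minimizers and the saddle point *)

Lemma dual_g_lt0 : 0 < mu -> mu < s ->
  exists t lam, [/\ 0 <= t, 0 <= lam & g t lam < 0].
Proof.
move=> mu0 mus; have [s0 sB] := andP s_itv.
have B0 : 0 < B by apply: lt_le_trans sB; exact: lt_trans mus.
have r1 : 1 < (s + mu) / (2 * mu) by rewrite ltr_pdivlMr ?mulr_gt0//; lra.
(* With lam = t e^{B t}, which dominates every xi(b_i, t), the dual is at most t (mu e^{B t} - s).
   This t makes mu e^{B t} the midpoint of mu and s. *)
pose t := ln ((s + mu) / (2 * mu)) / B.
have t0 : 0 < t by rewrite divr_gt0// ln_gt0.
have tB : expR (B * t) = (s + mu) / (2 * mu).
  by rewrite /t mulrC divfK ?gt_eqF// lnK// posrE (lt_trans ltr01).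
clearbody t.
exists t, (t * expR (B * t)); split; rewrite ?mulr_ge0 ?expR_ge0 ?(ltW t0)//.
apply: le_lt_trans (dual_g_le (ltW t0) _) _.
  move=> i; have bB : b i <= B.
    by rewrite (bigD1 i)//= lerDl sumr_ge0// => j _; exact: ltW.
  apply: le_trans (_ : t * expR (b i * t) <= _); last first.
    by rewrite ler_wpM2l ?(ltW t0)// ler_expR ler_wpM2r// ltW.
  rewrite /xi ler_pdivrMr// lerBlDr.
  have := expR_ge1Dx (- (b i * t)).
  have : expR (b i * t) * expR (- (b i * t)) = 1 by rewrite -expRD subrr expR0.
  have := expR_gt0 (b i * t); nra.
rewrite tB [ltLHS](_ : _ = t * ((mu - s) / 2)); last by field; rewrite gt_eqF.
by rewrite pmulr_rlt0//; lra.
Qed.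

Lemma dual_g_lam0 t : 0 <= t -> g t 0 = t * (B - s).
Proof.
move=> t0; rewrite dual_g_lagrangian /lagrangian mul0r addr0 mulrBr mulr_sumr.
congr (_ - _); apply: eq_bigr => i _.
rewrite /opt_means /tau_star eqxx /lnmgf mgfE// divff ?gt_eqF//.
by rewrite subrr add0r mul1r expRK mulrC.
Qed.

(* At a minimizer of the dual with t, lam > 0, the envelope inequalities force
   both partial derivatives of the Lagrangian to vanish; the means tau^*(t, lam)
   are then feasible and t minimizes their Chernoff exponent. *)
Lemma saddle_point t lam : 0 < t -> 0 < lam ->
  (forall t' lam', 0 <= t' -> 0 <= lam' -> g t lam <= g t' lam') ->
  ((g t lam)%:E <= chernoff_cramer_exponent b mu s)%E.
Proof.
move=> t0 lam0 g_min.
pose m t lam i := clipped_mean (b i) t lam.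
have mb t' lam' : box (m t' lam') by move=> i; exact: clipped_mean_itv.
have gE t' lam' : 0 < t' -> 0 < lam' -> g t' lam' = lagrangian (m t' lam') t' lam'.
  move=> t'0 lam'0; rewrite dual_g_lagrangian.
  by congr lagrangian; apply/funext => i; exact: tau_star_clipped.
have sum_m : mu - \sum_(i < n) m t lam i = 0.
  apply: (@sign_change_eq0 _ (fun l => mu - \sum_(i < n) m t l i) lam) => //.
    apply: cvgB; first exact: cvg_cst.
    apply: continuous_sum => i.
    by apply: (@clipped_mean_continuous _ _ (cst t) id) => //; exact: cvg_cst.
  (* The means optimal at l compete at lam, while g(t, lam) <= g(t, l); subtracting leaves (l - lam)
     (mu - sum m) >= 0. *)
  move=> l l0; have := g_min t l (ltW t0) (ltW l0).
  have := lagrangian_le (ltW t0) (ltW lam0) (mb t l).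
  rewrite (gE t l)// /lagrangian; lra.
have sum_tilted : \sum_(i < n) tilted_mean (b i) (m t lam i) t - s = 0.
  apply: (@sign_change_eq0 _ (fun t =>
      \sum_(i < n) tilted_mean (b i) (m t lam i) t - s) t) => //.
    apply: cvgB; last exact: cvg_cst.
    apply: continuous_sum => i.
    apply: (@tilted_mean_continuous _ (b i) (fun t => m t lam i)) => //.
    - exact: ltW.
    - by case/andP: (mb t lam i).
    apply: (@clipped_mean_continuous _ _ id (cst lam)) => //; exact: cvg_cst.
  move=> u u0; have := g_min u lam (ltW u0) (ltW lam0).
  have := lagrangian_le (ltW t0) (ltW lam0) (mb u lam).
  rewrite (gE u lam)// /lagrangian.
  (* The same comparison in t, with the tangent at u bounding the change of the Lagrangian from u to
     t. *)
  have : \sum_(i < n) lnmgf (b i) (m u lam i) u +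
      (t - u) * (\sum_(i < n) tilted_mean (b i) (m u lam i) u) <=
      \sum_(i < n) lnmgf (b i) (m u lam i) t.
    rewrite mulr_sumr -big_split/=; apply: ler_sum => i _.
    by apply: lnmgf_tangent => //; exact: ltW.
  lra.
apply: (@exponent_ge (m t lam)) => //; first by lra.
move=> u u0; rewrite gE// /lagrangian sum_m mulr0 addr0.
(* The tangent at t has total slope s, which cancels the term in s: t is a global minimizer for
   these means. *)
have : \sum_(i < n) lnmgf (b i) (m t lam i) t +
    (u - t) * (\sum_(i < n) tilted_mean (b i) (m t lam i) t) <=
    \sum_(i < n) lnmgf (b i) (m t lam i) u.
  rewrite mulr_sumr -big_split/=; apply: ler_sum => i _.
  by apply: lnmgf_tangent => //; exact: ltW.
rewrite (_ : \sum_(i < n) tilted_mean _ _ _ = s); last by lra.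
lra.
Qed.

Lemma dual_g_attained : s <= mu \/ (0 < mu /\ s < B) ->
  exists t lam, [/\ 0 <= t, 0 <= lam &
    ((g t lam)%:E <= chernoff_cramer_exponent b mu s)%E].
Proof.
have [s_mu _|mu_s [|[mu0 sB]]] := leP s mu.
- exists 0, 0; split => //; apply: le_trans (exponent_ge0 s_mu).
  by rewrite lee_fin dual_g00.
- by [].
have [t [lam [t0 lam0 g_min]]] := dual_g_min mu0 sB.
have g_lt0 : g t lam < 0.
  have [t' [lam' [t'0 lam'0]]] := dual_g_lt0 mu0 mu_s.
  exact: le_lt_trans (g_min _ _ t'0 lam'0).
exists t, lam; split => //; apply: saddle_point => //.
(* On both edges the dual is nonnegative: at least lam mu for t = 0, and equal to t (B - s) for lam
   = 0. The negative minimum is therefore interior. *)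
- rewrite lt_neqAle t0 andbT; apply/eqP => tE; move: g_lt0.
  apply/negP; rewrite -leNgt -tE; apply: le_trans (dual_g_ge (lexx 0) lam0).
  by rewrite mul0r subr0 mulr_ge0// ltW.
- rewrite lt_neqAle lam0 andbT; apply/eqP => lamE; move: g_lt0.
  apply/negP; rewrite -leNgt -lamE dual_g_lam0// mulr_ge0// subr_ge0 ltW//.
Qed.

(** * The boundary cases mu = 0 < s and mu < s = B *)

Lemma dual_g_unbounded y : mu = 0 -> 0 < s ->
  exists t lam, [/\ 0 <= t, 0 <= lam & g t lam <= y].
Proof.
move=> mu0 s0; pose t := `|y| / s; have t0 : 0 <= t by rewrite divr_ge0// ltW.
exists t, (\sum_(i < n) xi (b i) t); split => //.
  by apply: sumr_ge0 => i _; exact: xi_ge0.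
apply: le_trans (dual_g_le t0 _) _.
  by move=> i; rewrite (bigD1 i)//= lerDl sumr_ge0// => j _; exact: xi_ge0.
rewrite mu0 mulr0 add0r /t divfK ?gt_eqF// lerNl.
by rewrite -normrN ler_norm.
Qed.

(** The sum is continuous in u and runs from 0 at u = 0 to B at u = B, so the intermediate value
    theorem applies. *)
Lemma water_level : exists2 u, 0 <= u & \sum_(i < n) Num.min u (b i) = mu.
Proof.
have e0 : \sum_(i < n) Num.min 0 (b i) = 0.
  by rewrite big1// => i _; rewrite min_l// ltW.
have e1 : \sum_(i < n) Num.min B (b i) = B.
  apply: eq_bigr => i _; rewrite min_r// (bigD1 i)//= lerDl sumr_ge0// => j _.
  exact: ltW.
have [] := @IVT R (fun u => \sum_(i < n) Num.min u (b i)) 0 B mu.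
- exact: sum_widths_ge0.
- apply: continuous_subspaceT => u; apply: continuous_sum => i.
  by apply: (@continuous_min _ _ id (cst (b i))); [exact: cvg_id|exact: cvg_cst].
- by rewrite e0 e1 min_l ?max_r// sum_widths_ge0.
by move=> u; rewrite in_itv/= => /andP[u0 _] uE; exists u.
Qed.

(* As t -> +oo the dual tends to its limit with the multiplier u^-1 of the
   problem of maximizing sum ln (m_i / b_i) under sum m_i <= mu, whose solution
   is m_i = min(u, b_i). *)
Lemma dual_le_exponent_top : s = B -> 0 < mu ->
  (ereal_inf [set (g x.1 x.2)%:E | x in quadrant R] <=
    chernoff_cramer_exponent b mu s)%E.
Proof.
move=> sB mu0; have [u u_ge0 uE] := water_level.
have u0 : 0 < u.
  rewrite lt_neqAle u_ge0 andbT; apply/eqP => u_eq0; move: mu0.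
  by rewrite -uE big1 ?ltxx// => i _; rewrite -u_eq0 min_l// ltW.
pose m i := Num.min u (b i); have m0 i : 0 < m i by rewrite lt_min u0 b_gt0.
have mb : box m by move=> i; rewrite (ltW (m0 i)) ge_min lexx orbT.
apply: le_trans (_ : (\sum_(i < n) ln (m i / b i))%:E <= _)%E; last first.
  apply: (exponent_ge mb); first by rewrite uE.
  move=> t t0; rewrite lerBrDr sB mulr_sumr -big_split/=; apply: ler_sum => i _.
  by rewrite (mulrC t) lnmgf_ge_top// m0; case/andP: (mb i).
apply/lee_addgt0Pr => e e0; pose S := \sum_(i < n) (m i)^-1.
have S0 : 0 <= S by apply: sumr_ge0 => i _; rewrite invr_ge0 ltW.
have [t t0 St] : exists2 t, 0 < t & S / t <= e.
  exists ((S + 1) / e); first by rewrite divr_gt0// ltr_wpDl.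
  rewrite ler_pdivrMr ?divr_gt0 ?ltr_wpDl// mulrC divfK ?gt_eqF//.
  by rewrite lerDl.
apply: le_trans (_ : (g t u^-1)%:E <= _)%E.
  apply: ereal_inf_lbound; exists (t, u^-1) => //.
  by split => /=; rewrite ?invr_ge0 ltW.
rewrite -EFinD lee_fin dual_g_lagrangian /lagrangian sB.
set tau := opt_means t u^-1; have taub := opt_means_box t u^-1.
have : \sum_(i < n) (lnmgf (b i) (tau i) t - b i * t) <=
    \sum_(i < n) (ln (m i / b i) + u^-1 * (tau i - m i) + (m i)^-1 / t).
  apply: ler_sum => i _.
  apply: le_trans (lnmgf_le_top (b_gt0 i) u0 (taub i) (ltW t0)) _.
  rewrite lerD2l -/(m i) [leRHS]mulrC ler_wpM2r ?invr_ge0 ?(ltW (m0 i))//.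
  (* The error b_i e^{-b_i t} is at most 1/t, because z <= e^z. *)
  rewrite -ler_pdivlMr// expRN -invfM (mulrC t) lef_pV2 ?posrE ?expR_gt0 ?mulr_gt0//.
  by have := expR_ge1Dx (b i * t); lra.
(* Since the m_i sum to mu, the u^-1 terms cancel the multiplier term of the dual, leaving the error
   S / t. *)
rewrite !big_split/= sumrN -mulr_suml -mulr_sumr -mulr_suml sumrB -/S uE.
by move: St; lra.
Qed.

Lemma exponent_eq_dual : chernoff_cramer_exponent b mu s =
  ereal_inf [set (g x.1 x.2)%:E | x in quadrant R].
Proof.
have [mu_ge0 _] := andP mu_itv; have [s_ge0 s_le] := andP s_itv.
have attained : s <= mu \/ (0 < mu /\ s < B) -> chernoff_cramer_exponent b mu s =
    ereal_inf [set (g x.1 x.2)%:E | x in quadrant R].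
  by case/dual_g_attained => t [lam [t0 lam0 /(exponent_attained t0 lam0)[]]].
have [s_mu|mu_s] := leP s mu; first by apply: attained; left.
apply/le_anti; rewrite exponent_le_dual/=.
have [mu0|mu_neq0] := eqVneq mu 0.
  (* An extended real below every real number is -oo. *)
  have inf_le y : (ereal_inf [set (g x.1 x.2)%:E | x in quadrant R] <= y%:E)%E.
    have [t [lam [t0 lam0 g_le]]] := dual_g_unbounded y mu0 (le_lt_trans mu_ge0 mu_s).
    apply: le_trans (_ : (g t lam)%:E <= _)%E; last by rewrite lee_fin.
    by apply: ereal_inf_lbound; exists (t, lam).
  case: (ereal_inf [set (g x.1 x.2)%:E | x in quadrant R]) inf_le
    => [r /(_ (r - 1))|/(_ 0)|_] //; last exact: leNye.
  by rewrite lee_fin lerDl oppr_ge0 ler10.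
have mu_gt0 : 0 < mu by rewrite lt_neqAle eq_sym mu_neq0.
have [sB|sB] := eqVneq s B; first exact: dual_le_exponent_top.
by rewrite attained//; right; split; rewrite // lt_neqAle sB.
Qed.

End dual_function.

(** * The dual formula together with its convexity properties *)

Theorem theorem3p2 (R : realType) (n : nat) (b : 'I_n -> R) (mu s : R)
    (b_gt0 : forall i, 0 < b i)
    (mu_itv : 0 <= mu <= \sum_(i < n) b i)
    (s_itv : 0 <= s <= \sum_(i < n) b i) :
  [/\ convex_function (E := (R^o * R^o)%type) (quadrant R)
        (fun x => dual_g b mu s x.1 x.2),
      chernoff_cramer_exponent b mu s =
        ereal_inf [set (dual_g b mu s x.1 x.2)%:E | x in quadrant R]
      /\ (s <= mu \/ (0 < mu /\ s < \sum_(i < n) b i) ->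
          exists t lam : R, [/\ 0 <= t, 0 <= lam &
            chernoff_cramer_exponent b mu s = (dual_g b mu s t lam)%:E]),
      (forall t : R, 0 <= t -> exists2 lam : R, 0 <= lam &
          forall lam' : R, 0 <= lam' ->
            dual_g b mu s t lam <= dual_g b mu s t lam')
      /\ convex_function (E := R^o) [set t : R^o | 0 <= t]
          (fun t => inf [set dual_g b mu s t lam | lam in [set l : R | 0 <= l]])
    & forall t : R, 0 <= t ->
        convex_function (E := R^o) [set l : R^o | 0 <= l]
          (fun lam => dual_g b mu s t lam)].
Proof.
have set_ge0P (x : R) : x \in [set t : R^o | 0 <= t] -> 0 <= x.
  by rewrite inE.
split.
- move=> p x y; rewrite !inE => -[x1 x2] [y1 y2].
  by apply: dual_g_convex => //; rewrite ge0 le1.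
- split; first exact: exponent_eq_dual.
  move=> /(dual_g_attained b_gt0 mu_itv s_itv)[t [lam [t0 lam0 le_exp]]].
  by exists t, lam; split => //; have [] := exponent_attained b_gt0 t0 lam0 le_exp.
- split; first by move=> t t0; exact: dual_g_lam_min.
  move=> p x y /set_ge0P x0 /set_ge0P y0.
  by apply: dual_value_convex => //; rewrite ge0 le1.
- move=> t t0 p x y /set_ge0P x0 /set_ge0P y0.
  (* Writing t as a mixture of itself reduces convexity in lam to joint convexity. *)
  have tE : t = p%:num * t + (1 - p%:num) * t by ring.
  rewrite [in leLHS]tE.
  by apply: dual_g_convex => //; rewrite ge0 le1.
Qed.
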